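(* Let $p$ be an odd prime and let $G$ be a non-abelian $p$-group of order $p^4$ belonging to $\Phi_3$. Let $H$ be the unique abelian subgroup of $G$ of index $p$, and let $\chi \in \mathrm{nl}(G)$ be such that $\chi = \psi^G$ for some $\psi \in \mathrm{Irr}(H \mid G')$. Then $(H, \psi)$ is a required pair to determine an irreducible rational matrix representation of $G$ which affords the character $\Omega(\chi)$.
   Context: $\Phi_3$ is the isoclinism family (in James' classification) consisting of the groups of order $p^4$ of nilpotency class $3$; each such group has exactly one abelian subgroup of index $p$, and it contains $G'$. $\mathrm{nl}(G)$ is the set of irreducible complex characters of $G$ of degree $\neq1$, and $\mathrm{Irr}(H\mid G')=\{\psi\in\mathrm{Irr}(H) : G'\not\subseteq\ker\psi\}$. $\psi^G$ is the induced character. $\Omega(\chi)=m_{\mathbb{Q}}(\chi)\sum_{\sigma\in\mathrm{Gal}(\mathbb{Q}(\chi)/\mathbb{Q})}\chi^\sigma$, where $m_{\mathbb{Q}}(\chi)$ is the Schur index over $\mathbb{Q}$ (equal to $1$ here). For a $p$-group $G$ with $p$ odd, a required pair for an irreducible rational matrix representation affording $\Omega(\chi)$, $\chi\in\mathrm{Irr}(G)$, is a pair $(H,\psi)$ with $H\le G$, $\psi$ a linear character of $H$, $\psi^G=\chi$ and $\mathbb{Q}(\psi)=\mathbb{Q}(\chi)$, where $\mathbb{Q}(\cdot)$ is the field generated over $\mathbb{Q}$ by the character values. *)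

(* Defs.v *)
From HB Require Import structures.
From mathcomp Require Import all_boot all_order all_algebra.
From mathcomp Require Import all_fingroup all_solvable all_field all_character.

Set Implicit Arguments.
Unset Strict Implicit.
Unset Printing Implicit Defensive.

Import Order.TTheory GRing.Theory Num.Theory.
Local Open Scope ring_scope.

(* The groups of order p^4 in James' isoclinism family Phi_3 are exactly      *)
(* those of nilpotency class 3.                                               *)
Definition in_Phi3 (p : nat) (gT : finGroupType) (G : {group gT}) : Prop :=
  #|G| = (p ^ 4)%N /\ nil_class G = 3.

Definition nl (gT : finGroupType) (G : {group gT}) : {pred 'CF(G)} :=
  [pred chi | (chi \in irr G) && (chi 1%g != 1)].
Arguments nl {gT} G.

(* Irr(H | K), with K a subset of H, in practice a normal subgroup of H.      *)
Definition irr_over (gT : finGroupType) (H : {group gT}) (K : {set gT}) :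
    {pred 'CF(H)} :=
  [pred psi | (psi \in irr H) && ~~ (K \subset cfker psi)].
Arguments irr_over {gT} H K.

(* Membership in Q(phi), the least subfield of algC containing all the values *)
(* of phi; algC has characteristic 0, so every subfield contains Q.           *)
Definition in_value_field (gT : finGroupType) (G : {group gT})
    (phi : 'CF(G)) (x : algC) : Prop :=
  forall S : {pred algC},
    GRing.divring_closed S -> (forall g, g \in G -> phi g \in S) -> x \in S.

(* (H, psi) is a required pair for an irreducible rational matrix             *)
(* representation of G affording Omega(chi), where chi is an irreducible      *)
(* character of G and Omega(chi) is the sum of the Galois conjugates of chi   *)
(* over Q, times the Schur index of chi.  The conditions on (H, psi) involve  *)
(* chi only; the last one is the equality of fields Q(psi) = Q(chi).          *)
Definition required_pair (gT : finGroupType) (G : {group gT}) (chi : 'CF(G))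
    (H : {group gT}) (psi : 'CF(H)) : Prop :=
  [/\ H \subset G,
      psi \is a linear_char,
      'Ind[G] psi = chi
    & forall x : algC, in_value_field psi x <-> in_value_field chi x].

(* Main.v *)
Require Import Defs.
From HB Require Import structures.
From mathcomp Require Import all_boot all_order all_algebra.
From mathcomp Require Import all_fingroup all_solvable all_field all_character.

Set Implicit Arguments.
Unset Strict Implicit.
Unset Printing Implicit Defensive.

Import Order.TTheory GRing.Theory Num.Theory.
Local Open Scope ring_scope.

(** Since [chi] is induced from [psi], its values lie in Q(psi); the point is
    that each value of [psi] lies in Q(chi).  This is obtained by solving for
    [psi h] explicitly, without Galois theory.

    Two facts about [G] are used.  First, G' has exponent p: for [h] in [H] and
    [g] in [G], the element [g ^+ p] lies in the abelian group [H], so it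
    centralises [h], and expanding [h ^ (g ^+ p)] in class 3 leaves
    [[~ h, g] ^+ p = 1], because the odd prime p divides 'C(p, 2)
    ([commg_expg_eq1]).  It follows that the p-th powers of elements of [H] are
    central.  Secondly, the centre Z of [G] has order p ([card_center_class3]),
    and it contains every [[~ y, x]] with [y] in G'.

    Now a p-th root of unity other than 1 is found in Q(chi): if [y] in [H] has
    its [psi]-value unchanged by conjugation in [G], then [chi y = p * psi y],
    and there is such a [y] in G' with [psi y] a p-th root of unity other
    than 1.  Hence Q(chi) contains all p-th roots of unity.  There are two
    cases.

    If [psi] is trivial on Z, then [psi h ^+ p = psi (h ^+ p) = 1] for every [h]
    in [H], and nothing remains to be shown.

    If [psi] is not trivial on Z, then it is injective there, so the p
    conjugates of [psi] already differ on G'.  Orthogonality of linear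
    characters of G' then isolates [psi] among the constituents of the
    restriction of [chi] to [H] ([sum_cfInd_translates]): [psi h] is the average
    of [(psi y)^-1 * chi (h * y)] over [y] in G'.  The coefficients
    [(psi y)^-1] are p-th roots of unity, so [psi h] lies in Q(chi). *)

(** * Commutators with an abelian normal subgroup *)

(** Conjugation by [g] acts on the abelian group [H] as the operator
    [1 + N] with [N] the map [~ -, g]; this is the binomial expansion of
    [(1 + N) ^+ n] at [h], where [N ^+ 3] kills [h]. *)
Lemma conj_expg_binomial (gT : finGroupType) (H : {group gT}) (h g : gT) (n : nat) :
  abelian H -> h \in H -> g \in 'N(H)%g -> commute g [~ h, g, g]%g ->
  (h ^ (g ^+ n) = h * [~ h, g] ^+ n * [~ h, g, g] ^+ 'C(n, 2))%g.
Proof.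
move=> /centsP cHH Hh NHg cgb.
set a := [~ h, g]%g; set b := [~ a, g]%g.
have Ha : a \in H by rewrite /a commgEl groupM ?groupV ?memJ_norm.
have Hb : b \in H by rewrite /b commgEl groupM ?groupV ?memJ_norm.
elim: n => [|n IHn]; first by rewrite !expg0 conjg1 !mulg1.
rewrite expgSr conjgM IHn !conjMg !conjXg (conjg_mulR h) (conjg_mulR a).
have -> : (b ^ g = b)%g by rewrite conjgE -cgb mulKg.
rewrite -/a -/b binS bin1 expgMn; last exact: cHH.
by rewrite expgS addnC expgD !mulgA.
Qed.

(** As [g ^+ p] centralises [h], the binomial expansion of [h ^ (g ^+ p)] is [h]
    itself, and its quadratic term vanishes because the odd prime [p] divides
    'C(p, 2). *)
Lemma commg_expg_eq1 (gT : finGroupType) (p : nat) (H : {group gT}) (h g : gT) :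
  prime p -> odd p -> abelian H -> h \in H -> g \in 'N(H)%g -> (g ^+ p)%g \in H ->
  commute g [~ h, g, g]%g -> ([~ h, g, g] ^+ p = 1)%g -> ([~ h, g] ^+ p = 1)%g.
Proof.
move=> pr_p odd_p abH Hh NHg Hgp cgb bp1.
have p_gt2 : (2 < p)%N by rewrite odd_prime_gt2.
have := conj_expg_binomial p abH Hh NHg cgb.
have -> : ([~ h, g, g] ^+ 'C(p, 2) = 1)%g.
  have /dvdnP[k ->] : (p %| 'C(p, 2))%N by rewrite prime_dvd_bin.
  by rewrite mulnC expgM bp1 expg1n.
have -> : (h ^ (g ^+ p) = h)%g by rewrite conjgE ((centsP abH) h Hh _ Hgp) mulKg.
by rewrite mulg1 => /(canLR (mulKg _)) <-; rewrite mulVg.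
Qed.

(** Modulo [~: H, G] the image of [H] is central, so [G] becomes a product of two
    commuting abelian groups. *)
Lemma der1_commg_cyclic_index (gT : finGroupType) (G H : {group gT}) (g : gT) :
  (H <| G)%g -> abelian H -> (H * <[g]> = G)%g -> (G^`(1) \subset [~: H, G])%g.
Proof.
move=> nHG abH defG.
have nRG : G \subset 'N([~: H, G])%g by rewrite commg_normr.
have sHG := normal_sub nHG.
apply: der1_min => //.
suff: abelian ((H * <[g]>) / [~: H, G])%g by rewrite defG.
rewrite quotientMl ?(subset_trans sHG) //.
rewrite abelianM !quotient_abelian ?cycle_abelian //=.
rewrite quotient_cents2r // commGC commgS //.
by rewrite -defG mulG_subr.
Qed.

(** * Groups of order p^4 and class 3 *)

(** A centre of order at least p^2 would leave a central quotient of order at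
    most p^2, hence abelian, and the class would be at most 2. *)
Lemma card_center_class3 (gT : finGroupType) (p : nat) (G : {group gT}) :
  prime p -> #|G| = (p ^ 4)%N -> nil_class G = 3 -> #|'Z(G)%g| = p.
Proof.
move=> pr_p oG clG.
have pG : (p.-group G)%g by rewrite /pgroup oG pnatX pnat_id.
have ntZ : 'Z(G)%g != 1%g.
  apply/eqP => /(trivg_center_pgroup pG)/eqP.
  by rewrite -nil_class0 clG.
have [_ _ [[|k] oZ]] := pgroup_pdiv (pgroupS (center_sub G) pG) ntZ => //.
have : abelian (G / 'Z(G))%g.
  apply: (p2group_abelian (quotient_pgroup _ pG)).
  rewrite card_quotient ?gFnorm // -divgS ?center_sub // logn_div ?cardSg ?center_sub //.
  by rewrite oG oZ !pfactorK // !subSS leq_subr.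
by move/(der1_min (gFnorm _ _)); rewrite -nil_class2 clG.
Qed.

(** The last clause holds because an [x] outside the maximal subgroup [H] generates
    [G] together with [H]: if [x] centralised G', then G' would be central. *)
Lemma Phi3_structure (p : nat) (gT : finGroupType) (G H : {group gT}) :
  prime p -> odd p -> in_Phi3 p G ->
  H \subset G -> abelian H -> #|G : H|%g = p ->
  [/\ (G^`(1) \subset H)%g,
      {in G^`(1)%g & G, forall y x, [~ y, x]%g \in 'Z(G)%g},
      {in G^`(1)%g, forall y, (y ^+ p = 1)%g},
      {in H, forall h, (h ^+ p)%g \in 'Z(G)%g}
    & forall x, x \in G -> x \notin H ->
        exists2 y, y \in G^`(1)%g & [~ y, x]%g != 1%g].
Proof.
move=> pr_p odd_p [oG clG] sHG abH iHG.
have pG : (p.-group G)%g by rewrite /pgroup oG pnatX pnat_id.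
have nilG := pgroup_nil pG.
have oZ := card_center_class3 pr_p oG clG.
have maxH : maximal H G by rewrite p_index_maximal // iHG.
have nHG := p_maximal_normal pG maxH.
have sG'H : (G^`(1) \subset H)%g.
  rewrite der1_min ?normal_norm // cyclic_abelian // prime_cyclic //.
  by rewrite card_quotient ?normal_norm // iHG.
have L3Z : ([~: G^`(1), G] \subset 'Z(G))%g.
  have /(lcn_nil_classP _ nilG) : (nil_class G <= 3)%N by rewrite clG.
  rewrite lcnSn => /commG1P cL3.
  by rewrite subsetI -{2}lcn2 -lcnSn cL3 andbT lcn_sub.
have G'Z : {in G^`(1)%g & G, forall y x, [~ y, x]%g \in 'Z(G)%g}.
  by move=> y x G'y Gx; rewrite (subsetP L3Z) // mem_commg.
have HGp h g : h \in H -> g \in G -> ([~ h, g] ^+ p = 1)%g.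
  move=> Hh Gg.
  have Zb : [~ h, g, g]%g \in 'Z(G)%g.
    by rewrite G'Z // mem_commg // (subsetP sHG).
  apply: commg_expg_eq1 abH Hh _ _ _ _ => //.
  - exact: (subsetP (normal_norm nHG)).
  - have NHg := subsetP (normal_norm nHG) g Gg.
    apply: coset_idr; rewrite ?groupX // morphX //.
    by rewrite -iHG -card_quotient ?normal_norm // expg_cardG // mem_quotient.
  - by apply/esym; case/centerP: Zb => _; apply.
  - by rewrite -oZ expg_cardG.
have genG g : g \in G -> g \notin H -> (H * <[g]> = G)%g.
  by move=> Gg H'g; rewrite (mulg_normal_maximal nHG) ?cycle_subG.
split=> // [y G'y | h Hh | x Gx H'x].
  (* G' is generated by commutators of order dividing p in an abelian group. *)
  have /properP[_ [g Gg H'g]] := maxgroupp maxH.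
  have sG'R := der1_commg_cyclic_index nHG abH (genG g Gg H'g).
  have abR : abelian (commg_set H G).
    apply: abelianS abH; apply/subsetP => _ /imset2P[h x Hh Gx ->].
    by rewrite (subsetP sG'H) // mem_commg // (subsetP sHG).
  have : (exponent [~: H, G] %| p)%N.
    rewrite abelian_exponent_gen //; apply/exponentP => _ /imset2P[h x Hh Gx ->].
    exact: HGp.
  by move/exponentP; apply; rewrite (subsetP sG'R).
  (* [h ^ x] differs from [h] by an element of order dividing p in [H]. *)
  apply/centerP; split=> [|x Gx]; first by rewrite groupX // (subsetP sHG).
  have hxp : ((h ^ x) ^+ p = h ^+ p)%g.
    rewrite conjg_mulR expgMn ?HGp ?mulg1 //.
    by apply: (centsP abH); rewrite // (subsetP sG'H) // mem_commg // (subsetP sHG).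
  by rewrite /commute conjgC conjXg hxp.
have cl_gt2 : ~~ (nil_class G <= 2)%N by rewrite clG.
apply/exists_inP; apply: contraNT cl_gt2 => /exists_inPn cG'x.
rewrite nil_class2 subsetI der_sub /=.
suff: (G^`(1) \subset 'C(H * <[x]>))%g by rewrite genG.
rewrite centM subsetI centsC (sub_abelian_cent abH sG'H) cent_cycle; apply/subsetP => y G'y.
by apply/cent1P/commgP; exact: negbNE (cG'x y G'y).
Qed.

(** * Recovering a linear character from the character it induces *)

(** Expanding the induced character gives, for each [x] in [G], the term
    [psi (h ^ x)] times the sum over [A] of the linear character
    [y |-> (psi y)^-1 * psi (y ^ x)].  That character is trivial when [x] lies in
    [H] and nontrivial otherwise, so only the conjugate [psi] itself survives. *)
Lemma sum_cfInd_translates (gT : finGroupType) (G H A : {group gT})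
    (psi : 'CF(H)) (h : gT) :
  (H <| G)%g -> A \subset H -> psi \is a linear_char -> h \in H ->
  (forall x, x \in G -> x \notin H -> exists2 y, y \in A & psi (y ^ x)%g != psi y) ->
  \sum_(y in A) (psi y)^-1 * 'Ind[G] psi (h * y)%g = #|A|%:R * psi h.
Proof.
move=> nHG sAH linpsi Hh moved.
have sHG := normal_sub nHG.
have HJ x y : x \in G -> y \in H -> (y ^ x)%g \in H.
  by move=> Gx Hy; rewrite memJ_norm // (subsetP (normal_norm nHG)).
have HA y : y \in A -> y \in H by exact: (subsetP sAH).
pose f x y : algC := (psi y)^-1 * psi (y ^ x)%g.
have sumf x : x \in G -> \sum_(y in A) f x y = if x \in H then #|A|%:R else 0.
  move=> Gx; case: ifPn => [Hx | H'x].
    rewrite -sumr_const; apply: eq_bigr => y Ay.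
    by rewrite /f cfunJ // mulVf // lin_char_neq0 ?HA.
  have [y0 Ay0 nf1] := moved x Gx H'x.
  (* [f x] is multiplicative and differs from 1 at [y0], so translating the
     sum by [y0] shows that it is zero. *)
  have fM y : y \in A -> f x (y0 * y)%g = f x y0 * f x y.
    move=> Ay; rewrite /f conjMg (lin_charM linpsi) ?HA //.
    by rewrite lin_charM ?HJ ?HA // invfM mulrACA.
  apply/eqP; suff: (f x y0 - 1) * (\sum_(y in A) f x y) == 0.
    rewrite mulf_eq0 subr_eq0 => /orP[fy01|//]; case/eqP: nf1.
    rewrite -[LHS](mulVKf (lin_char_neq0 linpsi (HA _ Ay0))).
    by rewrite -/(f x y0) (eqP fy01) mulr1.
  rewrite mulrBl mul1r subr_eq0 mulr_sumr; apply/eqP.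
  rewrite [RHS](reindex_inj (mulgI y0)) /=.
  by apply: eq_big => [y | y Ay]; rewrite ?groupMl ?fM.
have -> : \sum_(y in A) (psi y)^-1 * 'Ind[G] psi (h * y)%g
    = #|H|%:R^-1 * \sum_(x in G) psi (h ^ x)%g * \sum_(y in A) f x y.
  under eq_bigr => y Ay do rewrite cfIndE // mulrCA mulr_sumr.
  rewrite -mulr_sumr exchange_big; congr (_ * _); apply: eq_bigr => x Gx.
  rewrite mulr_sumr; apply: eq_bigr => y Ay.
  by rewrite conjMg (lin_charM linpsi) ?HJ ?(HA y) // /f mulrCA.
have -> : \sum_(x in G) psi (h ^ x)%g * \sum_(y in A) f x y
    = \sum_(x in H) psi h * #|A|%:R.
  rewrite [RHS]big_mkcond [LHS]big_mkcond; apply: eq_bigr => x _.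
  case: ifPn => [Gx | G'x]; last by rewrite (contraNF (subsetP sHG x)).
  by rewrite sumf //; case: ifP => [Hx | _]; rewrite ?mulr0 ?cfunJ.
rewrite sumr_const -(mulr_natl (_ * _)) mulKf ?neq0CG //.
by rewrite mulrC.
Qed.

Lemma cfInd_conj_invariant (gT : finGroupType) (G H : {group gT})
    (psi : 'CF(H)) (y : gT) :
  H \subset G -> (forall x, x \in G -> psi (y ^ x)%g = psi y) ->
  'Ind[G] psi y = #|G : H|%g%:R * psi y.
Proof.
move=> sHG inv; rewrite cfIndE // (eq_bigr _ inv) sumr_const -(mulr_natl (psi y)).
by rewrite -(Lagrange sHG) natrM -mulrA mulKf ?neq0CG.
Qed.

(** As [p] is prime, [w] is primitive, so every p-th root of unity is a power
    of it. *)
Lemma mem_divring_prime_unity_root (p : nat) (S : divringClosed algC) (w x : algC) :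
  prime p -> w != 1 -> w ^+ p = 1 -> w \in S -> x ^+ p = 1 -> x \in S.
Proof.
move=> pr_p w_neq1 wp1 Sw xp1.
have [m prim_w m_dv_p] := prim_order_exists (prime_gt0 pr_p) wp1.
have {m m_dv_p} prim_w : p.-primitive_root w.
  have /pred2P[m1 | <- //] := (primeP pr_p).2 m m_dv_p.
  have := prim_expr_order prim_w; rewrite m1.
  by rewrite expr1 => /eqP; rewrite (negPf w_neq1).
by have [i ->] := prim_rootP prim_w xp1; rewrite rpredX.
Qed.

Lemma lin_char_cfker (gT : finGroupType) (H : {group gT}) (psi : 'CF(H)) (z : gT) :
  psi \is a linear_char -> z \in H -> (z \in cfker psi) = (psi z == 1).
Proof.
by move=> linpsi Hz; rewrite cfkerEchar ?lin_charW // inE Hz lin_char1.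
Qed.

(** * The field of values *)

Lemma in_value_field_cfInd (gT : finGroupType) (G H : {group gT})
    (psi : 'CF(H)) (x : algC) :
  H \subset G -> in_value_field ('Ind[G] psi) x -> in_value_field psi x.
Proof.
move=> sHG chi_x S divS S_psi; apply: chi_x => // g Gg.
pose SD : divringClosed algC := HB.pack S (GRing.isDivringClosed.Build _ S divS).
have S_psi' y : psi y \in SD.
  by have [/S_psi // | H'y] := boolP (y \in H); rewrite cfun0 ?rpred0.
by rewrite cfIndE // (rpredM (s := SD)) ?rpredV ?rpred_nat ?rpred_sum.
Qed.

Theorem theorem56 (p : nat) (gT : finGroupType) (G H : {group gT})
    (chi : 'CF(G)) (psi : 'CF(H)) :
  prime p -> odd p ->
  ~~ abelian G -> in_Phi3 p G ->
  H \subset G -> abelian H -> #|G : H|%g = p ->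
  chi \in nl G ->
  psi \in irr_over H (G^`(1))%g ->
  chi = 'Ind[G] psi ->
  required_pair chi psi.
Proof.
move=> pr_p odd_p nabG Phi3G sHG abH iHG _ /andP[/irrP[i def_psi] ntG'] ->.
have linpsi : psi \is a linear_char by rewrite def_psi; apply/char_abelianP.
split=> // x; split; last exact: in_value_field_cfInd.
move=> psi_x S divS S_chi; apply: psi_x => // {x} h Hh.
have [sG'H G'Z G'p HpZ moved] := Phi3_structure pr_p odd_p Phi3G sHG abH iHG.
have nHG : (H <| G)%g by exact: sub_der1_normal.
have oZ := card_center_class3 pr_p Phi3G.1 Phi3G.2.
pose SD : divringClosed algC := HB.pack S (GRing.isDivringClosed.Build _ S divS).
rewrite -[_ \in S]/(psi h \in SD).
have HG' y : y \in G^`(1)%g -> y \in H by exact: (subsetP sG'H).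
have HR y x : y \in G^`(1)%g -> x \in G -> [~ y, x]%g \in H.
  by move=> G'y Gx; rewrite HG' // mem_commg // (subsetP sHG) ?HG'.
have psiG'p y : y \in G^`(1)%g -> psi y ^+ p = 1.
  by move=> G'y; rewrite -lin_charX ?HG' // G'p // lin_char1.
(* An element [y] as below gives [chi y = p * psi y], hence one, and then every,
   p-th root of unity in the field [S]. *)
have S_roots y (x : algC) : y \in G^`(1)%g -> psi y != 1 ->
    (forall g, g \in G -> psi (y ^ g)%g = psi y) -> x ^+ p = 1 -> x \in SD.
  move=> G'y nt_y inv_y; apply: mem_divring_prime_unity_root (nt_y) _ _ => //.
    exact: psiG'p.
  have := S_chi y (subsetP sHG y (HG' y G'y)).
  rewrite cfInd_conj_invariant // iHG => S_py.
  have p_neq0 : p%:R != 0 :> algC by rewrite pnatr_eq0 -lt0n prime_gt0.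
  by rewrite -(mulKf p_neq0 (psi y)) (rpredM (s := SD)) ?rpredV ?rpred_nat.
(* If [psi] is trivial on Z, it is [G]-invariant on G' and has p-th roots of unity
   as its values. *)
have [sZK | nsZK] := boolP ('Z(G)%g \subset cfker psi).
  have /subsetPn[y G'y nKy] := ntG'.
  apply: (S_roots y) => //; first by rewrite -lin_char_cfker ?HG'.
    move=> g Gg; rewrite conjg_mulR (lin_charM linpsi) ?HR ?HG' //.
    have /eqP-> : psi [~ y, g]%g == 1; last by rewrite mulr1.
    by rewrite -lin_char_cfker ?HR // (subsetP sZK) ?G'Z.
  rewrite -(lin_charX linpsi) //; apply/eqP.
  by rewrite -lin_char_cfker ?(subsetP sZK) ?HpZ ?groupX.
(* Otherwise [psi] is injective on Z, which has prime order, so it separates the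
   central elements [[~ y, x]] from 1. *)
have nt_comm y x : y \in G^`(1)%g -> x \in G -> [~ y, x]%g != 1%g ->
    psi [~ y, x]%g != 1.
  move=> G'y Gx; apply: contra; rewrite -lin_char_cfker ?HR // => K_yx.
  by apply/eqP/set1gP; rewrite -(prime_TIg _ nsZK) ?oZ // inE K_yx G'Z.
have [x Gx H'x] : exists2 x, x \in G & x \notin H.
  by apply/subsetPn; apply: contra nabG => /abelianS; apply.
have [y G'y nt_yx] := moved x Gx H'x.
have S_psiG' u : u \in G^`(1)%g -> psi u \in SD.
  move=> G'u; apply: (S_roots [~ y, x]%g); rewrite ?nt_comm ?psiG'p //.
    by rewrite mem_commg // (subsetP sHG) ?HG'.
  have /centerP[_ cGyx] := G'Z y x G'y Gx.
  by move=> g Gg; rewrite conjgE (cGyx g Gg) mulKg.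
(* [x] outside [H] moves [psi] on G', since [psi (u ^ x) = psi u * psi [~ u, x]]. *)
have nzA : #|G^`(1)%g|%:R != 0 :> algC by rewrite neq0CG.
rewrite -(mulKf nzA (psi h)) -(sum_cfInd_translates nHG sG'H linpsi Hh).
  rewrite (rpredM (s := SD)) ?rpredV ?rpred_nat // rpred_sum // => u G'u.
  rewrite (rpredM (s := SD)) ?rpredV ?S_psiG' //.
  by apply: S_chi; rewrite (subsetP sHG) // groupM ?(HG' u).
move=> v Gv H'v; have [u G'u nt_uv] := moved v Gv H'v; exists u => //.
rewrite conjg_mulR (lin_charM linpsi) ?HR ?HG' //.
rewrite -subr_eq0 -{2}[psi u]mulr1 -mulrBr mulf_neq0 ?subr_eq0 ?nt_comm //.
by rewrite lin_char_neq0 ?HG'.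
Qed.
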